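(* Let $\alpha,\beta\in\mathbb R$, let $(a_n)_{n\ge 0}$ be a sequence of real numbers with $a_n^2\ne 1$ for all $n\ge 0$, and let $(\lambda_n)_{n\ge0}$ be a sequence of real numbers. Let $K=\mathrm{diag}(\lambda_0,\lambda_1,\lambda_2,\dots)$ and let $M_1,M_2$ be the semi-infinite block-diagonal matrices (rows and columns indexed by $0,1,2,\dots$) $$M_1=\mathrm{diag}\left(1,\ B(a_1),\ B(a_3),\ B(a_5),\dots\right),\qquad M_2=\mathrm{diag}\left(B(a_0),\ B(a_2),\ B(a_4),\dots\right),$$ where $$B(a)=\begin{pmatrix} a & 1\\ 1-a^2 & -a\end{pmatrix}.$$ Suppose that $K,M_1,M_2$ satisfy the circle Jacobi algebra relations $$\{K,M_1\}=(\alpha+\beta+1)(M_1-\mathcal I),\qquad \{K,M_2\}=(\alpha+\beta+2)M_2+(\alpha-\beta)\mathcal I .$$ Then $$\lambda_{2n}=-n\quad (n\ge 0),\qquad \lambda_{2n-1}=\alpha+\beta+n+1\quad (n\ge 1),$$ and $$a_n=-\frac{\alpha+\tfrac12+(-1)^{n+1}\left(\beta+\tfrac12\right)}{n+\alpha+\beta+2},\qquad n=0,1,2,\dots$$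
   Context: $\{X,Y\}=XY+YX$ denotes the anticommutator and $\mathcal I$ the identity matrix. In $M_1$ the first block is the $1\times1$ block $(1)$ at index $0$, and the block $B(a_{2k-1})$ occupies indices $2k-1,2k$ for $k\ge1$; in $M_2$ the block $B(a_{2k})$ occupies indices $2k,2k+1$ for $k\ge 0$. (These matrices satisfy $M_1^2=M_2^2=\mathcal I$.) All matrix products are well defined since every matrix has finitely many nonzero entries in each row and column. *)

(* Defs.v *)
From mathcomp Require Import all_boot all_order all_algebra.
From mathcomp Require Import boolp classical_sets functions fsbigop reals.

Set Implicit Arguments.
Unset Strict Implicit.
Unset Printing Implicit Defensive.

Import Order.TTheory GRing.Theory Num.Theory.
Local Open Scope classical_set_scope.
Local Open Scope ring_scope.

(* Semi-infinite matrices.  Addition, opposite and scaling are the pointwise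
   ones of the function space; R^o is R as a module over itself. *)
Notation smx R := (nat -> nat -> R^o).

Section SemiInfiniteMatrix.
Variable R : realType.
Implicit Types A B : smx R.

Definition diag_smx (d : nat -> R) : smx R :=
  fun i j => if i == j then d i else 0.

Definition id_smx : smx R := diag_smx (fun=> 1).

(* A finitely supported sum: it is the matrix product as soon as the rows of A
   (or the columns of B) have finitely many nonzero entries.  The product [*]
   of the function space is pointwise and must not be used here. *)
Definition mul_smx A B : smx R :=
  fun i j => \sum_(k \in [set: nat]) A i k * B k j.

Definition anticomm A B : smx R := mul_smx A B + mul_smx B A.

(* diag(C 0, C 1, C 2, ...), with C k in rows and columns 2k, 2k+1 *)
Definition blockdiag_smx (C : nat -> 'M[R]_2) : smx R :=
  fun i j => if i./2 == j./2 then C i./2 (inord (odd i)) (inord (odd j)) else 0.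

(* diag(c, A), with the entries of A shifted by one row and one column *)
Definition bordered_smx (c : R) A : smx R :=
  fun i j => match i, j with
             | 0, 0 => c
             | i'.+1, j'.+1 => A i' j'
             | _, _ => 0
             end.

Definition block (a : R) : 'M[R]_2 :=
  \matrix_(i < 2, j < 2)
    (nth [::] [:: [:: a;          1];
                  [:: 1 - a ^+ 2; - a]] i)`_j.

Definition M1 (a : nat -> R) : smx R :=
  bordered_smx 1 (blockdiag_smx (fun k => block (a (2 * k + 1)%N))).

Definition M2 (a : nat -> R) : smx R :=
  blockdiag_smx (fun k => block (a (2 * k)%N)).

End SemiInfiniteMatrix.

Arguments id_smx {R}.

(* Main.v *)
Require Import Defs.
From mathcomp Require Import all_boot all_order all_algebra.
From mathcomp Require Import classical_sets fsbigop reals functions.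
From mathcomp Require Import lra.

Import Order.TTheory GRing.Theory Num.Theory.
Local Open Scope ring_scope.

(** Since [{K, M} i j = (lam i + lam j) * M i j], the off-diagonal entries equal
to [1] give [lam n + lam n.+1], hence [lam] from [lam 0 = 0], and the diagonal
entries give [(n + alpha + beta + 2) * a n = - p], where [p] is [alpha - beta]
for even [n] and [alpha + beta + 1] for odd [n].  When the coefficient of [a n]
vanishes, [alpha + beta + 1 = - (n + 1)]: for odd [n] this contradicts [p = 0],
and for [n = 2k] the equation for [a (4k + 1)] forces [a (4k + 1) = 1]. *)

Lemma fsum_singleton {R : realType} (i : nat) (F : nat -> R) :
  (forall k, k != i -> F k = 0) -> \sum_(k \in [set: nat]) F k = F i.
Proof.
move=> F0; rewrite -(@fsbig_widen _ _ _ _ [set i]) ?fsbig_set1 //.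
by move=> k [_ /= /eqP]; exact: F0.
Qed.

Lemma natr_double {R : realType} k : k.*2%:R = k%:R + k%:R :> R.
Proof. by rewrite -addnn natrD. Qed.

(** A diagonal matrix has at most one nonzero entry per row and column, so each of the two sums
    collapses to a single term. *)
Lemma anticomm_diag_smx {R : realType} (d : nat -> R) (A : smx R) i j :
  anticomm (diag_smx d) A i j = (d i + d j) * A i j.
Proof.
rewrite /anticomm /mul_smx !fctE (@fsum_singleton _ i) => [|k neq_ki].
  rewrite (@fsum_singleton _ j) => [|k neq_kj].
    by rewrite /diag_smx !eqxx mulrDl [A i j * _]mulrC.
  by rewrite /diag_smx (negbTE neq_kj) mulr0.
by rewrite /diag_smx eq_sym (negbTE neq_ki) mul0r.
Qed.

(** The top row of a block carries both facts used later: its entry [1] yields the recurrence for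
    [lam], its entry [b k] the equation for [a]. *)
Lemma blockdiag_smx_block {R : realType} (b : nat -> R) k :
  let A := blockdiag_smx (fun k => block (b k)) in
  A k.*2 k.*2 = b k /\ A k.*2 k.*2.+1 = 1.
Proof.
rewrite /= /blockdiag_smx /= uphalf_double doubleK eqxx odd_double /=.
by rewrite !mxE !inordK.
Qed.

Lemma M1_block {R : realType} (a : nat -> R) k :
  M1 a k.*2.+1 k.*2.+1 = a k.*2.+1 /\ M1 a k.*2.+1 k.*2.+2 = 1.
Proof.
have := blockdiag_smx_block (fun k => a (2 * k + 1)%N) k.
by rewrite /= mul2n addn1.
Qed.

Lemma M2_block {R : realType} (a : nat -> R) k :
  M2 a k.*2 k.*2 = a k.*2 /\ M2 a k.*2 k.*2.+1 = 1.
Proof.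
by have := blockdiag_smx_block (fun k => a (2 * k)%N) k; rewrite /= mul2n.
Qed.

Section CircleJacobi.
Variables (R : realType) (alpha beta : R) (a lam : nat -> R).
Hypothesis (hM1 : anticomm (diag_smx lam) (M1 a) =
  (alpha + beta + 1) *: (M1 a - id_smx)).
Hypothesis (hM2 : anticomm (diag_smx lam) (M2 a) =
  (alpha + beta + 2) *: M2 a + (alpha - beta) *: id_smx).

Lemma M1_entry i j : (lam i + lam j) * M1 a i j =
  (alpha + beta + 1) * (M1 a i j - (i == j)%:R).
Proof.
rewrite -anticomm_diag_smx hM1 !fctE /id_smx /diag_smx.
by case: eqP.
Qed.

Lemma M2_entry i j : (lam i + lam j) * M2 a i j =
  (alpha + beta + 2) * M2 a i j + (alpha - beta) * (i == j)%:R.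
Proof.
rewrite -anticomm_diag_smx hM2 !fctE /id_smx /diag_smx.
by case: eqP.
Qed.

(** [M1] and the identity agree at the corner, so the right-hand side of the first relation vanishes
    there. *)
Lemma lam0 : lam 0%N = 0.
Proof. by have := M1_entry 0 0; rewrite /M1 /= => h; lra. Qed.

Lemma lam_odd_even k : lam k.*2.+1 + lam k.*2.+2 = alpha + beta + 1.
Proof.
have := M1_entry k.*2.+1 k.*2.+2.
have [_ ->] := M1_block a k.
by rewrite eqSS ltn_eqF //= => h; lra.
Qed.

Lemma lam_even_odd k : lam k.*2 + lam k.*2.+1 = alpha + beta + 2.
Proof.
have := M2_entry k.*2 k.*2.+1.
have [_ ->] := M2_block a k.
by rewrite ltn_eqF //= => h; lra.
Qed.

(** Subtracting the two recurrences gives [lam k.*2.+2 - lam k.*2 = -1]. *)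
Lemma lam_even k : lam k.*2 = - k%:R.
Proof.
elim: k => [|k IHk]; first by rewrite lam0 oppr0.
have := lam_odd_even k; have := lam_even_odd k.
by rewrite doubleS -natr1 IHk => h1 h2; lra.
Qed.

Lemma lam_odd k : lam k.*2.+1 = alpha + beta + k%:R + 2.
Proof. by have := lam_even_odd k; rewrite lam_even => h; lra. Qed.

Lemma a_even k :
  (k.*2%:R + alpha + beta + 2) * a k.*2 = - (alpha - beta).
Proof.
have := M2_entry k.*2 k.*2.
have [-> _] := M2_block a k.
by rewrite eqxx /= lam_even natr_double => h; lra.
Qed.

Lemma a_odd k :
  (k.*2.+1%:R + alpha + beta + 2) * a k.*2.+1 = - (alpha + beta + 1).
Proof.
have := M1_entry k.*2.+1 k.*2.+1.
have [-> _] := M1_block a k.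
by rewrite eqxx /= lam_odd -(natr1 k.*2) natr_double => h; lra.
Qed.

(** Since [x / 0 = 0] in the library, the quotient formula for [a n] rests on this fact; [ha] enters
    here. *)
Lemma a_denom_neq0 (ha : forall n, a n ^+ 2 != 1) n :
  n%:R + alpha + beta + 2 != 0.
Proof.
apply/eqP => den0; rewrite -(odd_double_half n) in den0.
move: n./2 den0 => k; case: (odd n); rewrite ?add1n ?add0n => den0.
  (* [a_odd] now reads [alpha + beta + 1 = 0], which turns [den0] into [2k + 2 = 0]. *)
  have := a_odd k; have := ler0n R k; rewrite den0 mul0r.
  by move: den0; rewrite -(natr1 k.*2) natr_double; lra.
have num_neq0 : k.*2%:R + 1 != 0 :> R by rewrite natr1 pnatr_eq0.
(* The index [4k + 1] is chosen so that, with [alpha + beta = -(2k + 2)], the coefficient and the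
   right-hand side of [a_odd] both equal [2k + 1]. *)
have /eqP[] := ha k.*2.*2.+1.
suff -> : a k.*2.*2.+1 = 1 by rewrite expr1n.
apply: (mulfI num_neq0); have := a_odd k.*2.
rewrite -(natr1 k.*2.*2) (natr_double k.*2) => h.
(* [lra] takes the products with [a] as atoms, so [alpha + beta] is replaced inside the product
   first. *)
have sumE : alpha + beta = - (k.*2%:R + 2) by lra.
by move: h; rewrite -[_ + alpha + beta]addrA sumE => h; lra.
Qed.

(** The sign merges the two parities: the halves add up to [1] for odd [n] and cancel for even
    [n]. *)
Lemma a_eq n : (n%:R + alpha + beta + 2) * a n =
  - (alpha + 1 / 2 + (-1) ^+ n.+1 * (beta + 1 / 2)).
Proof.
rewrite -(odd_double_half n) -signr_odd.
move: n./2 => k; case: (odd n); rewrite ?add1n ?add0n.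
  by rewrite a_odd /= odd_double /= expr0; lra.
by rewrite a_even /= odd_double /= expr1; lra.
Qed.

End CircleJacobi.

Theorem mainTheorem2 (R : realType) (alpha beta : R) (a lam : nat -> R)
  (ha : forall n : nat, a n ^+ 2 != 1)
  (hM1 : anticomm (diag_smx lam) (M1 a) =
         (alpha + beta + 1) *: (M1 a - id_smx))
  (hM2 : anticomm (diag_smx lam) (M2 a) =
         (alpha + beta + 2) *: M2 a + (alpha - beta) *: id_smx) :
  (forall n : nat, lam (2 * n)%N = - n%:R) /\
  (forall n : nat, (1 <= n)%N ->
     lam (2 * n - 1)%N = alpha + beta + n%:R + 1) /\
  (forall n : nat,
     n%:R + alpha + beta + 2 != 0 /\
     a n = - ((alpha + 1 / 2 + (-1) ^+ n.+1 * (beta + 1 / 2)) /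
              (n%:R + alpha + beta + 2))).
Proof.
split=> [n|]; first by rewrite mul2n (lam_even _ _ _ _ _ hM1 hM2).
split=> [[//|n] _|n].
  (* Here [n] stands for the original index minus one, so the index of [lam] becomes [2n + 1]. *)
  rewrite mul2n doubleS subn1 /= (lam_odd _ _ _ _ _ hM1 hM2) -natr1.
  by lra.
have den_neq0 := a_denom_neq0 _ _ _ _ _ hM1 hM2 ha n; split=> //.
apply: (mulfI den_neq0); rewrite (a_eq _ _ _ _ _ hM1 hM2).
by rewrite mulrN mulrCA divff // mulr1.
Qed.
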